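(* Let $0\le\sigma\le1/3$ and let $f\in S^*_{lim}$, i.e. $f\in\mathscr{A}$ with $$\frac{zf'(z)}{f(z)}\prec(1+z)(1-\sigma z).$$ Then $$\|P_f\|\le\frac{(1-\sigma+2\sigma t_\sigma)(1+t_\sigma)}{1+\sigma t_\sigma}+(1-t_\sigma^2)(1-\sigma+\sigma t_\sigma),$$ where $t_\sigma$ is the unique root in $(0,1)$ of the equation $$\frac{-3\sigma^3t^4+(2\sigma^3-8\sigma^2)t^3+(\sigma^3+6\sigma^2-7\sigma)t^2+(2\sigma^2+6\sigma-2)t+\sigma^2+\sigma+1}{(1+\sigma t)^2}=0.$$
   Context: $\mathbb{D}=\{z\in\mathbb{C}:|z|<1\}$. $\mathscr{A}$ is the class of analytic functions $f$ on $\mathbb{D}$ with $f(0)=0$, $f'(0)=1$. For analytic $g,h$ on $\mathbb{D}$, $g\prec h$ (subordination) means $g=h\circ\omega$ for some analytic $\omega:\mathbb{D}\to\mathbb{D}$ with $\omega(0)=0$. For $f\in\mathscr{A}$ with $f'\ne0$ in $\mathbb{D}$, $P_f(z)=f''(z)/f'(z)$ and $\|P_f\|=\sup_{z\in\mathbb{D}}(1-|z|^2)|P_f(z)|$. *)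

(* Defs.v *)
From Stdlib Require Import Reals.
From Coquelicot Require Import Coquelicot.

Open Scope R_scope.

Definition unit_disk (z : C) : Prop := Cmod z < 1.

(* Complex differentiability at every point; since the disk is open, the values
   of g outside the disk are irrelevant to this and to C_derive g inside. *)
Definition analytic_on_disk (g : C -> C) : Prop :=
  forall z : C, unit_disk z -> @ex_derive C_AbsRing C_NormedModule g z.

Definition class_A (f : C -> C) : Prop :=
  analytic_on_disk f /\ f (RtoC 0) = RtoC 0 /\ C_derive f (RtoC 0) = RtoC 1.

Definition subordinate (g h : C -> C) : Prop :=
  exists w : C -> C,
    analytic_on_disk w /\
    (forall z : C, unit_disk z -> unit_disk (w z)) /\
    w (RtoC 0) = RtoC 0 /\
    (forall z : C, unit_disk z -> g z = h (w z)).

(* z f'(z) / f(z), with the removable singularity of a normalized f at the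
   origin filled in by its limit 1. *)
Definition zf'_over_f (f : C -> C) (z : C) : C :=
  if Ceq_dec z (RtoC 0) then RtoC 1 else (z * C_derive f z / f z)%C.

Definition limacon (sigma : R) (z : C) : C :=
  ((RtoC 1 + z) * (RtoC 1 - RtoC sigma * z))%C.

(* The nonvanishing clause says that the quotient is genuinely defined on the
   punctured disk (division in C is total, with value 0 at a zero divisor). *)
Definition S_lim (sigma : R) (f : C -> C) : Prop :=
  class_A f /\
  (forall z : C, unit_disk z -> z <> RtoC 0 -> f z <> RtoC 0) /\
  subordinate (zf'_over_f f) (limacon sigma).

Definition pre_schwarzian (f : C -> C) (z : C) : C :=
  (C_derive (C_derive f) z / C_derive f z)%C.

(* The supremum is taken in the extended reals, so an unbounded set has norm
   p_infty. *)
Definition pre_schwarzian_norm (f : C -> C) : Rbar :=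
  Lub_Rbar (fun x : R => exists z : C, unit_disk z /\
    x = (1 - Cmod z ^ 2) * Cmod (pre_schwarzian f z)).

(* Main.v *)
Require Import Defs.
From Stdlib Require Import Reals Lra Lia.
From Coquelicot Require Import Coquelicot.
Open Scope R_scope.

(** Write [p = z f' / f = limacon sigma o w] with [w] a self-map of the disk
    fixing [0]. Taking logarithmic derivatives of [f' = p f / z] gives
    [f'' / f' = p' / p + (p - 1) / z]. Here [p'] contains [w'], and the
    Schwarz-Pick inequality [|w'| (1 - |z|^2) <= 1 - |w|^2] together with
    [|w z| <= |z|] bounds [(1 - |z|^2) |f'' / f'|] by a function [radial_bound]
    of [s = |w z|] alone. The derivative of that function in [s] is the rational
    function of the theorem. Its numerator is concave on the positive axis,
    positive at [0] and negative at [1], hence has exactly one root [t] in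
    [(0, 1)], and [radial_bound] attains its maximum there.

    Analyticity means complex differentiability at each point, so the Schwarz
    lemmas are derived from Goursat's theorem. It is proved on rectangles, for
    real differential forms whose coefficients are merely differentiable
    ([goursat]). Pulled back by the exponential it says that the means of [g z / z]
    over circles about [0] do not depend on the radius
    ([circle_integral_constant]). Comparing small radii with radii near [1] gives
    [|g' 0| <= 1] ([schwarz_origin]), and disk automorphisms turn this into
    [schwarz_pick]. The growth estimate [schwarz] follows by integrating along a
    radius.

    The value of the pre-Schwarzian at [0] is a derivative of [f'] at [0], and
    the formula above degenerates there. It is recovered from the fact that
    [f / z] has derivative [(f / z) (p - 1) / z] away from [0], which has a limit
    at [0] ([is_Cderive_removable]). *)

(** * Complex derivatives *)

Notation is_Cderive := (@is_derive C_AbsRing C_NormedModule).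

Lemma unit_disk_0 : unit_disk (RtoC 0).
Proof. unfold unit_disk. rewrite Cmod_0. lra. Qed.

Lemma is_Cderive_eps (f : C -> C) (z l : C) :
  is_Cderive f z l <->
  forall eps, 0 < eps -> exists d, 0 < d /\ forall y, Cmod (y - z) < d ->
    Cmod (f y - f z - (y - z) * l) <= eps * Cmod (y - z).
Proof.
split.
- intros [_ H] eps Heps.
  specialize (H z (fun P HP => HP) (mkposreal eps Heps)).
  destruct H as [d Hd].
  exists d; split; [apply cond_pos |].
  intros y Hy. exact (Hd y Hy).
- intros H; split.
  + apply is_linear_scal_l.
  + intros x Hx eps.
    assert (Hxz : z = x) by exact (is_filter_lim_locally_unique (K:=C_AbsRing) (V:=AbsRing_NormedModule C_AbsRing) z x Hx).
    subst x.
    destruct (H eps (cond_pos eps)) as [d [Hd Hy]].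
    exists (mkposreal d Hd). intros y Hb. exact (Hy y Hb).
Qed.

(** The field [C] carries two normed-module structures over itself with the same
    norm; the product and chain rules are stated for the first, [C_derive] uses
    the second. *)
Lemma is_Cderive_AbsRing (f : C -> C) (z l : C) :
  @is_derive C_AbsRing (AbsRing_NormedModule C_AbsRing) f z l <-> is_Cderive f z l.
Proof.
split; intros [Hl H]; (split; [apply is_linear_scal_l | exact H]).
Qed.

Lemma is_Cderive_id (z : C) : is_Cderive (fun w => w) z (RtoC 1).
Proof. apply is_Cderive_AbsRing. exact (@is_derive_id C_AbsRing z). Qed.

Lemma is_Cderive_const (c z : C) : is_Cderive (fun _ => c) z (RtoC 0).
Proof. exact (@is_derive_const C_AbsRing C_NormedModule c z). Qed.

Lemma is_Cderive_plus (f g : C -> C) (z df dg : C) :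
  is_Cderive f z df -> is_Cderive g z dg ->
  is_Cderive (fun w => f w + g w)%C z (df + dg)%C.
Proof. exact (@is_derive_plus C_AbsRing C_NormedModule f g z df dg). Qed.

Lemma is_Cderive_minus (f g : C -> C) (z df dg : C) :
  is_Cderive f z df -> is_Cderive g z dg ->
  is_Cderive (fun w => f w - g w)%C z (df - dg)%C.
Proof. exact (@is_derive_minus C_AbsRing C_NormedModule f g z df dg). Qed.

Lemma is_Cderive_mult (f g : C -> C) (z df dg : C) :
  is_Cderive f z df -> is_Cderive g z dg ->
  is_Cderive (fun w => f w * g w)%C z (df * g z + f z * dg)%C.
Proof.
intros Hf Hg. apply is_Cderive_AbsRing in Hf, Hg. apply is_Cderive_AbsRing.
exact (@is_derive_mult C_AbsRing f g z df dg Hf Hg Cmult_comm).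
Qed.

Lemma is_Cderive_comp (f g : C -> C) (z df dg : C) :
  is_Cderive f (g z) df -> is_Cderive g z dg ->
  is_Cderive (fun w => f (g w)) z (dg * df)%C.
Proof.
intros Hf Hg. apply is_Cderive_AbsRing in Hg.
exact (@is_derive_comp C_AbsRing C_NormedModule f g z df dg Hf Hg).
Qed.

Lemma is_Cderive_inv (z : C) : z <> RtoC 0 -> is_Cderive Cinv z (- / (z * z))%C.
Proof.
intros Hz. apply is_Cderive_eps. intros eps Heps.
assert (Hm : 0 < Cmod z) by now apply Cmod_gt_0.
set (m := Cmod z) in *.
assert (Hm3 : 0 < m ^ 3) by (apply pow_lt; lra).
exists (Rmin (m / 2) (eps * m ^ 3 / 2)); split.
{ apply Rmin_pos; nra. }
intros y Hy.
assert (Hy1 : Cmod (y - z) < m / 2) by (eapply Rlt_le_trans; [exact Hy | apply Rmin_l]).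
assert (Hy2 : Cmod (y - z) < eps * m ^ 3 / 2) by (eapply Rlt_le_trans; [exact Hy | apply Rmin_r]).
assert (Hym : m / 2 < Cmod y).
{ assert (m <= Cmod y + Cmod (y - z)); [| lra].
  unfold m. replace z with (y - (y - z))%C at 1 by ring.
  unfold Cminus at 1. eapply Rle_trans; [apply Cmod_triangle |].
  rewrite Cmod_opp. lra. }
assert (Hy0 : y <> RtoC 0) by (apply Cmod_gt_0; lra).
replace (/ y - / z - (y - z) * - / (z * z))%C
  with ((y - z) * ((y - z) / (z * z * y)))%C by (field; auto).
rewrite Cmod_mult, Cmod_div by (repeat apply Cmult_neq_0; auto).
rewrite !Cmod_mult. fold m.
rewrite Rmult_comm. apply Rmult_le_compat_r; [apply Cmod_ge_0 |].
apply Rle_div_l; [nra |].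
apply Rlt_le, Rlt_le_trans with (1 := Hy2).
replace (eps * m ^ 3 / 2) with (eps * (m * m * (m / 2))) by field.
apply Rmult_le_compat_l; [lra |]. apply Rmult_le_compat_l; nra.
Qed.

Lemma is_Cderive_div (f g : C -> C) (z df dg : C) :
  is_Cderive f z df -> is_Cderive g z dg -> g z <> RtoC 0 ->
  is_Cderive (fun w => f w / g w)%C z ((df * g z - f z * dg) / (g z * g z))%C.
Proof.
intros Hf Hg H0.
replace ((df * g z - f z * dg) / (g z * g z))%C
  with (df * / g z + f z * (dg * - / (g z * g z)))%C by (field; auto).
apply (is_Cderive_mult f (fun w => / g w)%C); [exact Hf |].
exact (is_Cderive_comp Cinv g z _ _ (is_Cderive_inv (g z) H0) Hg).
Qed.

(** Differentiability is local, so an identity valid on a small disk (typically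
    inside the punctured or the full unit disk) is enough to transfer it. *)
Lemma is_Cderive_ext_near (f g : C -> C) (z l : C) (d : R) : 0 < d ->
  (forall w, Cmod (w - z) < d -> f w = g w) ->
  is_Cderive f z l -> is_Cderive g z l.
Proof.
intros Hd H. apply is_derive_ext_loc.
exists (mkposreal d Hd). intros w Hw. apply H. exact Hw.
Qed.

Lemma is_Cderive_eq (f : C -> C) (z l m : C) : is_Cderive f z l -> l = m -> is_Cderive f z m.
Proof. now intros H <-. Qed.

Lemma is_Cderive_C_derive (f : C -> C) (z : C) :
  analytic_on_disk f -> unit_disk z -> is_Cderive f z (C_derive f z).
Proof. intros Hf Hz. apply C_derive_correct; [exact z | now apply Hf]. Qed.

(** The Cauchy-Riemann equations: multiplication by [l] is the real matrix
    with rows [(Re l, - Im l)] and [(Im l, Re l)]. *)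
Lemma is_Cderive_differentiable_pt_lim (f : C -> C) (x y : R) (l : C) :
  is_Cderive f (x, y) l ->
  differentiable_pt_lim (fun u v => Re (f (u, v))) x y (Re l) (- Im l) /\
  differentiable_pt_lim (fun u v => Im (f (u, v))) x y (Im l) (Re l).
Proof.
intros H. rewrite is_Cderive_eps in H.
assert (Hs : 0 < sqrt 2) by (apply sqrt_lt_R0; lra).
assert (K : forall eps : posreal, locally_2d (fun u v =>
   Cmod (f (u, v) - f (x, y) - ((u, v) - (x, y)) * l)%C
   <= eps * Rmax (Rabs (u - x)) (Rabs (v - y))) x y).
{ intros eps.
  assert (He : 0 < eps / sqrt 2) by (apply Rdiv_lt_0_compat; [apply cond_pos | lra]).
  destruct (H _ He) as [d [Hd Hy]].
  assert (Hd2 : 0 < d / sqrt 2) by (apply Rdiv_lt_0_compat; lra).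
  exists (mkposreal _ Hd2). simpl. intros u v Hu Hv.
  pose proof (Cmod_2Rmax ((u, v) - (x, y))%C) as HM. simpl in HM.
  fold (u - x) in HM. fold (v - y) in HM.
  set (M := Rmax (Rabs (u - x)) (Rabs (v - y))) in *.
  assert (HMd : M < d / sqrt 2) by (apply Rmax_lub_lt; assumption).
  apply Rlt_div_r in HMd; [| exact Hs].
  eapply Rle_trans; [apply Hy; lra |].
  eapply Rle_trans; [apply Rmult_le_compat_l; [lra | exact HM] |].
  right. field. lra. }
split; intros eps; destruct (K eps) as [d Hd]; exists d; intros u v Hu Hv;
  specialize (Hd u v Hu Hv); eapply Rle_trans; try exact Hd;
  (eapply Rle_trans; [| apply Rmax_Cmod]);
  [eapply Rle_trans; [| apply Rmax_l] | eapply Rle_trans; [| apply Rmax_r]];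
  right; f_equal; unfold Re, Im; simpl; ring.
Qed.

(** * Goursat's theorem on rectangles *)

(** The integral of the form [P dx + Q dy] along the counterclockwise boundary
    of the rectangle [[a, b] x [c, d]]. *)
Definition circulation (P Q : R -> R -> R) (a b c d : R) : R :=
  RInt (fun x => P x c) a b + RInt (fun y => Q b y) c d
  - RInt (fun x => P x d) a b - RInt (fun y => Q a y) c d.

Lemma differentiable_pt_lim_continuous_l (f : R -> R -> R) (x y lx ly : R) :
  differentiable_pt_lim f x y lx ly -> continuous (fun u => f u y) x.
Proof.
intros H. apply continuity_pt_filterlim, derivable_continuous_pt.
exists lx. replace lx with (lx * 1 + ly * 0) by ring.
apply (derivable_pt_lim_comp_2d f (fun u => u) (fun _ => y)); [exact H | |].
- apply derivable_pt_lim_id.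
- apply derivable_pt_lim_const.
Qed.

Lemma differentiable_pt_lim_continuous_r (f : R -> R -> R) (x y lx ly : R) :
  differentiable_pt_lim f x y lx ly -> continuous (fun v => f x v) y.
Proof.
intros H. apply continuity_pt_filterlim, derivable_continuous_pt.
exists ly. replace ly with (lx * 0 + ly * 1) by ring.
apply (derivable_pt_lim_comp_2d f (fun _ => x) (fun v => v)); [exact H | |].
- apply derivable_pt_lim_const.
- apply derivable_pt_lim_id.
Qed.

Section Goursat.
Variables P Q : R -> R -> R.

(** The shared coefficient [k] is the equation [P_y = Q_x]. Nothing is assumed
    about continuity of the partial derivatives, so Green's formula is not
    applicable and Goursat's subdivision takes its place. *)
Definition closed_at (x y : R) : Prop :=
  exists p k q, differentiable_pt_lim P x y p k /\ differentiable_pt_lim Q x y k q.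

Definition closed_on (a b c d : R) : Prop :=
  forall x y, a <= x <= b -> c <= y <= d -> closed_at x y.

Lemma closed_on_ex_RInt (a b c d : R) : a <= b -> c <= d -> closed_on a b c d ->
  (forall a' b' y, a <= a' -> a' <= b' -> b' <= b -> c <= y <= d -> ex_RInt (fun x => P x y) a' b') /\
  (forall c' d' x, c <= c' -> c' <= d' -> d' <= d -> a <= x <= b -> ex_RInt (fun y => Q x y) c' d').
Proof.
intros Hab Hcd H. split; intros u v w H1 H2 H3 H4; apply (ex_RInt_continuous (V := R_CompleteNormedModule));
  intros s; rewrite Rmin_left, Rmax_right by lra; intros Hs.
- destruct (H s w) as (p & k & q & HP & HQ); [lra | lra |].
  exact (differentiable_pt_lim_continuous_l P s w _ _ HP).
- destruct (H w s) as (p & k & q & HP & HQ); [lra | lra |].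
  exact (differentiable_pt_lim_continuous_r Q w s _ _ HQ).
Qed.

Lemma circulation_split4 (a b c d m n : R) :
  a <= m <= b -> c <= n <= d -> closed_on a b c d ->
  circulation P Q a b c d =
    circulation P Q a m c n + circulation P Q m b c n
    + circulation P Q a m n d + circulation P Q m b n d.
Proof.
intros Hm Hn H.
destruct (closed_on_ex_RInt a b c d) as [HP HQ]; [lra | lra | exact H |].
unfold circulation.
assert (EP : forall y, c <= y <= d ->
  RInt (fun x => P x y) a b = RInt (fun x => P x y) a m + RInt (fun x => P x y) m b).
{ intros y Hy. symmetry.
  apply (RInt_Chasles (V := R_CompleteNormedModule) (fun x => P x y)); apply HP; lra. }
assert (EQ : forall x, a <= x <= b ->
  RInt (fun y => Q x y) c d = RInt (fun y => Q x y) c n + RInt (fun y => Q x y) n d).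
{ intros x Hx. symmetry.
  apply (RInt_Chasles (V := R_CompleteNormedModule) (fun y => Q x y)); apply HQ; lra. }
rewrite !EP, !EQ by lra. ring.
Qed.

(** A closed form with affine coefficients has zero circulation, because the
    two [k]-terms cancel; only the deviation from the affine parts at [(x0, y0)]
    contributes, by at most [eps] times the perimeter. *)
Lemma circulation_affine_error (a b c d x0 y0 p k q eps : R) :
  a <= b -> c <= d -> closed_on a b c d -> 
  a <= x0 <= b -> c <= y0 <= d ->
  (forall x y, a <= x <= b -> c <= y <= d ->
    Rabs (P x y - P x0 y0 - (p * (x - x0) + k * (y - y0))) <= eps /\
    Rabs (Q x y - Q x0 y0 - (k * (x - x0) + q * (y - y0))) <= eps) ->
  Rabs (circulation P Q a b c d) <= 2 * eps * ((b - a) + (d - c)).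
Proof.
intros Hab Hcd H Hx0 Hy0 Hest.
destruct (closed_on_ex_RInt a b c d) as [HP HQ]; [lra | lra | exact H |].
assert (Eaff : forall al be u v, is_RInt (fun t => al + be * t) u v
   (al * (v - u) + be * (v ^ 2 - u ^ 2) / 2)).
{ intros al be u v.
  replace (al * (v - u) + be * (v ^ 2 - u ^ 2) / 2)
    with (minus (al * v + be * v ^ 2 / 2) (al * u + be * u ^ 2 / 2))
    by (unfold minus, plus, opp; simpl; field).
  apply (is_RInt_derive (fun t => al * t + be * t ^ 2 / 2)).
  - intros t _. auto_derive; [trivial | field].
  - intros t _. apply continuity_pt_filterlim. reg. }
(* along a side the coefficient is affine in one variable up to eps *)
assert (Es : forall (f : R -> R) al be u v, u <= v -> ex_RInt f u v ->
   (forall t, u <= t <= v -> Rabs (f t - (al + be * t)) <= eps) ->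
   Rabs (RInt f u v - (al * (v - u) + be * (v ^ 2 - u ^ 2) / 2)) <= (v - u) * eps).
{ intros f al be u v Huv Hf Hb.
  pose proof (Eaff al be u v) as HA.
  rewrite <- (is_RInt_unique _ _ _ _ HA).
  assert (HA' : ex_RInt (fun t => al + be * t) u v) by (eexists; exact HA).
  replace (RInt f u v - RInt (fun t => al + be * t) u v)
    with (RInt (fun t => f t - (al + be * t)) u v)
    by exact (RInt_minus (V := R_CompleteNormedModule) f (fun t => al + be * t) u v Hf HA').
  apply abs_RInt_le_const; [exact Huv | | exact Hb].
  exact (ex_RInt_minus (V := R_CompleteNormedModule) f (fun t => al + be * t) u v Hf HA'). }
assert (S1 := Es (fun x => P x c) (P x0 y0 - p * x0 + k * (c - y0)) p a b Hab
  ltac:(apply HP; lra)).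
assert (S3 := Es (fun x => P x d) (P x0 y0 - p * x0 + k * (d - y0)) p a b Hab
  ltac:(apply HP; lra)).
assert (S2 := Es (fun y => Q b y) (Q x0 y0 - q * y0 + k * (b - x0)) q c d Hcd
  ltac:(apply HQ; lra)).
assert (S4 := Es (fun y => Q a y) (Q x0 y0 - q * y0 + k * (a - x0)) q c d Hcd
  ltac:(apply HQ; lra)).
assert (T1 := S1 ltac:(intros t Ht; refine (Rle_trans _ _ _ (Req_le _ _ _) (proj1 (Hest t c Ht ltac:(lra)))); f_equal; ring)).
assert (T3 := S3 ltac:(intros t Ht; refine (Rle_trans _ _ _ (Req_le _ _ _) (proj1 (Hest t d Ht ltac:(lra)))); f_equal; ring)).
assert (T2 := S2 ltac:(intros t Ht; refine (Rle_trans _ _ _ (Req_le _ _ _) (proj2 (Hest b t ltac:(lra) Ht))); f_equal; ring)).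
assert (T4 := S4 ltac:(intros t Ht; refine (Rle_trans _ _ _ (Req_le _ _ _) (proj2 (Hest a t ltac:(lra) Ht))); f_equal; ring)).
clear S1 S2 S3 S4.
unfold circulation.
apply Rabs_le_between in T1, T2, T3, T4. apply Rabs_le_between.
split; nra.
Qed.

(** One step of Goursat's subdivision: the lower-left corner of a quarter on
    which the circulation is at least a fourth of the previous one. By
    additivity the four quarters cannot all be smaller, so the last one
    qualifies when the first three do not. *)
Definition quarter (w h : R) (n : nat) (xy : R * R) : R * R :=
  let (x, y) := xy in
  let w' := w / 2 ^ S n in
  let h' := h / 2 ^ S n in
  let J x y := Rabs (circulation P Q x (x + w') y (y + h')) in
  let M := Rabs (circulation P Q x (x + 2 * w') y (y + 2 * h')) / 4 in
  if Rle_dec M (J x y) then (x, y)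
  else if Rle_dec M (J (x + w') y) then (x + w', y)
  else if Rle_dec M (J x (y + h')) then (x, y + h')
  else (x + w', y + h').

Fixpoint corner (a c w h : R) (n : nat) : R * R :=
  match n with
  | O => (a, c)
  | S n => quarter w h n (corner a c w h n)
  end.

Lemma halving_limit (u : nat -> R) (w : R) : 0 <= w ->
  (forall n, u n <= u (S n) /\ u (S n) + w / 2 ^ S n <= u n + w / 2 ^ n) ->
  exists l, forall n, u n <= l <= u n + w / 2 ^ n.
Proof.
intros Hw Hu.
assert (Hpos : forall n, 0 <= w / 2 ^ n).
{ intros n. apply Rmult_le_pos; [exact Hw |].
  apply Rlt_le, Rinv_0_lt_compat, pow_lt; lra. }
assert (Hle : forall n m, u n <= u (n + m)%nat /\ u (n + m)%nat + w / 2 ^ (n + m) <= u n + w / 2 ^ n).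
{ intros n m; induction m as [| m IH].
  - rewrite Nat.add_0_r; lra.
  - rewrite Nat.add_succ_r. pose proof (Hu (n + m)%nat). lra. }
destruct (completeness (fun x => exists n, x = u n)) as [l [Hub Hlub]].
- exists (u 0%nat + w / 2 ^ 0). intros x [n ->].
  pose proof (Hle 0%nat n). simpl (0 + n)%nat in *. pose proof (Hpos n). lra.
- now exists (u 0%nat), 0%nat.
- exists l. intros n; split.
  + apply Hub. now exists n.
  + apply Hlub. intros x [m ->].
    destruct (Nat.le_gt_cases n m) as [L | L].
    * destruct (Hle n (m - n)%nat) as [_ E]. replace (n + (m - n))%nat with m in E by lia.
      pose proof (Hpos m). lra.
    * destruct (Hle m (n - m)%nat) as [E _]. replace (m + (n - m))%nat with n in E by lia.
      pose proof (Hpos n). lra.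
Qed.

(** Around the common point of the chosen quarters the form is affine up to
    [o(diameter)], so the [n]-th circulation is [o(4^-n)]; it is also at least
    [4^-n] times the original one. *)
Theorem goursat (a b c d : R) : a <= b -> c <= d ->
  closed_on a b c d -> circulation P Q a b c d = 0.
Proof.
intros Hab Hcd H.
set (w := b - a). set (h := d - c).
set (X n := fst (corner a c w h n)). set (Y n := snd (corner a c w h n)).
assert (Hpos : forall s n, 0 <= s -> 0 <= s / 2 ^ n).
{ intros s n Hs. apply Rmult_le_pos; [exact Hs |].
  apply Rlt_le, Rinv_0_lt_compat, pow_lt; lra. }
assert (Hhalf : forall s n, s / 2 ^ n = 2 * (s / 2 ^ S n)).
{ intros s n. simpl. field. apply pow_nonzero; lra. }
assert (Hstep : forall n,
  (X (S n) = X n \/ X (S n) = X n + w / 2 ^ S n) /\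
  (Y (S n) = Y n \/ Y (S n) = Y n + h / 2 ^ S n)).
{ intros n. unfold X, Y. simpl corner. unfold quarter.
  destruct (corner a c w h n) as [x y].
  repeat destruct Rle_dec; simpl; auto. }
assert (HX : forall n, X n <= X (S n) /\ X (S n) + w / 2 ^ S n <= X n + w / 2 ^ n).
{ intros n. rewrite (Hhalf w n).
  assert (0 <= w / 2 ^ S n) by (apply Hpos; unfold w; lra).
  destruct (Hstep n) as [[-> | ->] _]; lra. }
assert (HY : forall n, Y n <= Y (S n) /\ Y (S n) + h / 2 ^ S n <= Y n + h / 2 ^ n).
{ intros n. rewrite (Hhalf h n).
  assert (0 <= h / 2 ^ S n) by (apply Hpos; unfold h; lra).
  destruct (Hstep n) as [_ [-> | ->]]; lra. }
assert (Hin : forall n, (a <= X n /\ X n + w / 2 ^ n <= b) /\ (c <= Y n /\ Y n + h / 2 ^ n <= d)).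
{ induction n as [| n IH].
  - unfold X, Y, w, h; simpl; lra.
  - pose proof (HX n). pose proof (HY n). lra. }
assert (Hsub : forall n, closed_on (X n) (X n + w / 2 ^ n) (Y n) (Y n + h / 2 ^ n)).
{ intros n x y Hx Hy. pose proof (Hin n). apply H; lra. }
set (J n := Rabs (circulation P Q (X n) (X n + w / 2 ^ n) (Y n) (Y n + h / 2 ^ n))).
assert (HJS : forall n, J n <= 4 * J (S n)).
{ intros n.
  pose proof (circulation_split4 (X n) (X n + w / 2 ^ n) (Y n) (Y n + h / 2 ^ n)
    (X n + w / 2 ^ S n) (Y n + h / 2 ^ S n)) as E.
  assert (Hw : 0 <= w / 2 ^ S n) by (apply Hpos; unfold w; lra).
  assert (Hh : 0 <= h / 2 ^ S n) by (apply Hpos; unfold h; lra).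
  specialize (E ltac:(rewrite (Hhalf w n); lra) ltac:(rewrite (Hhalf h n); lra) (Hsub n)).
  revert E. unfold J. rewrite (Hhalf w n), (Hhalf h n).
  unfold X, Y. simpl corner. unfold quarter.
  destruct (corner a c w h n) as [x y]. cbv [fst snd].
  set (w' := w / 2 ^ S n) in *. set (h' := h / 2 ^ S n) in *.
  replace (x + 2 * w') with (x + w' + w') by ring.
  replace (y + 2 * h') with (y + h' + h') by ring.
  intros E.
  repeat destruct Rle_dec; cbv [fst snd]; try lra.
  rewrite E in *.
  set (A1 := circulation P Q x (x + w') y (y + h')) in *.
  set (A2 := circulation P Q (x + w') (x + w' + w') y (y + h')) in *.
  set (A3 := circulation P Q x (x + w') (y + h') (y + h' + h')) in *.
  set (A4 := circulation P Q (x + w') (x + w' + w') (y + h') (y + h' + h')) in *.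
  pose proof (Rabs_triang (A1 + A2 + A3) A4).
  pose proof (Rabs_triang (A1 + A2) A3).
  pose proof (Rabs_triang A1 A2). lra. }
assert (HJ : forall n, J 0%nat <= 4 ^ n * J n).
{ induction n as [| n IH]; [simpl; lra |].
  eapply Rle_trans; [exact IH |].
  replace (4 ^ S n * J (S n)) with (4 ^ n * (4 * J (S n))) by (simpl; ring).
  apply Rmult_le_compat_l; [apply pow_le; lra | apply HJS]. }
destruct (halving_limit X w ltac:(unfold w; lra) HX) as [x0 Hx0].
destruct (halving_limit Y h ltac:(unfold h; lra) HY) as [y0 Hy0].
assert (Hc : closed_at x0 y0).
{ pose proof (Hx0 0%nat). pose proof (Hy0 0%nat). pose proof (Hin 0%nat). apply H; lra. }
destruct Hc as (p & k & q & HP & HQ).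
assert (Hwh : 0 <= w + h) by (unfold w, h; lra).
assert (HJ0 : J 0%nat = Rabs (circulation P Q a b c d)).
{ unfold J, X, Y, w, h. simpl. do 2 f_equal; field. }
assert (Hbound : forall eps : posreal, Rabs (circulation P Q a b c d) <= 2 * eps * (w + h) ^ 2).
{ intros eps. rewrite <- HJ0.
  destruct (HP eps) as [d1 Hd1]. destruct (HQ eps) as [d2 Hd2].
  set (del := Rmin d1 d2).
  assert (Hdel : 0 < del) by (apply Rmin_pos; apply cond_pos).
  destruct (pow_lt_1_zero (/ 2) ltac:(rewrite Rabs_pos_eq; lra) (del / (w + h + 1))
     ltac:(apply Rdiv_lt_0_compat; lra)) as [N HN].
  specialize (HN N (Nat.le_refl N)).
  rewrite Rabs_pos_eq in HN by (apply pow_le; lra). rewrite pow_inv in HN.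
  assert (H2N : 0 < 2 ^ N) by (apply pow_lt; lra).
  assert (Hsmall : (w + h) / 2 ^ N < del).
  { unfold Rdiv at 1.
    apply Rlt_div_r in HN; [| lra]. assert (0 < / 2 ^ N) by now apply Rinv_0_lt_compat. nra. }
  assert (Hw : 0 <= w / 2 ^ N) by (apply Hpos; unfold w; lra).
  assert (Hh : 0 <= h / 2 ^ N) by (apply Hpos; unfold h; lra).
  replace ((w + h) / 2 ^ N) with (w / 2 ^ N + h / 2 ^ N) in Hsmall by (field; lra).
  assert (Hdl : del <= d1 /\ del <= d2) by (split; [apply Rmin_l | apply Rmin_r]).
  pose proof (Hx0 N) as Hx0N. pose proof (Hy0 N) as Hy0N.
  assert (E : J N <= 2 * (eps * (w / 2 ^ N + h / 2 ^ N)) *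
     ((X N + w / 2 ^ N - X N) + (Y N + h / 2 ^ N - Y N))).
  { apply (circulation_affine_error _ _ _ _ x0 y0 p k q); try lra; [apply Hsub |].
    intros x y Hx Hy.
    assert (Hax : Rabs (x - x0) <= w / 2 ^ N) by (apply Rabs_le_between; lra).
    assert (Hay : Rabs (y - y0) <= h / 2 ^ N) by (apply Rabs_le_between; lra).
    assert (HM : Rmax (Rabs (x - x0)) (Rabs (y - y0)) <= w / 2 ^ N + h / 2 ^ N)
      by (apply Rmax_lub; lra).
    pose proof (cond_pos eps).
    split; (eapply Rle_trans; [| apply Rmult_le_compat_l; [lra | exact HM]]);
      [apply Hd1 | apply Hd2]; lra. }
  eapply Rle_trans; [apply (HJ N) |].
  eapply Rle_trans; [apply Rmult_le_compat_l; [apply pow_le; lra | exact E] |].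
  right. replace (4 ^ N) with (2 ^ N * 2 ^ N) by (rewrite <- Rpow_mult_distr; f_equal; ring).
  field. lra. }
apply Rabs_eq_0. apply Rle_antisym; [| apply Rabs_pos].
apply Rle_plus_epsilon. intros e He.
assert (Hq : 0 < 2 * (w + h) ^ 2 + 1) by nra.
assert (He' : 0 < e / (2 * (w + h) ^ 2 + 1)) by (apply Rdiv_lt_0_compat; lra).
pose proof (Hbound (mkposreal _ He')) as HB. cbv [pos] in HB.
eapply Rle_trans; [exact HB |].
rewrite Rplus_0_l.
replace (2 * (e / (2 * (w + h) ^ 2 + 1)) * (w + h) ^ 2)
  with (e * ((2 * (w + h) ^ 2) / (2 * (w + h) ^ 2 + 1))) by (field; lra).
rewrite <- (Rmult_1_r e) at 2. apply Rmult_le_compat_l; [lra |].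
apply Rle_div_l; lra.
Qed.
End Goursat.

(** * Circle means and the Schwarz-Pick inequality *)

(** The complex exponential of [x + i y]. It turns concentric circles into
    vertical segments, so that rectangles suffice for Cauchy's theorem on
    annuli. *)
Definition expC (x y : R) : C := (exp x * cos y, exp x * sin y).

Lemma Cmod_expC (x y : R) : Cmod (expC x y) = exp x.
Proof.
unfold Cmod, expC. cbv [fst snd].
replace ((exp x * cos y) ^ 2 + (exp x * sin y) ^ 2)
  with (exp x * exp x * ((sin y)² + (cos y)²)) by (unfold Rsqr; ring).
rewrite sin2_cos2, Rmult_1_r. apply sqrt_square, Rlt_le, exp_pos.
Qed.

Lemma expC_neq_0 (x y : R) : expC x y <> RtoC 0.
Proof. apply Cmod_gt_0. rewrite Cmod_expC. apply exp_pos. Qed.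

Lemma differentiable_pt_lim_snd (f : R -> R) (x y l : R) :
  derivable_pt_lim f y l -> differentiable_pt_lim (fun _ v => f v) x y 0 l.
Proof.
intros Hf.
pose proof (differentiable_pt_lim_comp (fun u _ => f u) (fun _ v => v) (fun _ v => v)
  x y l 0 0 1 0 1) as H.
replace (l * 0 + 0 * 0) with 0 in H by ring.
replace (l * 1 + 0 * 1) with l in H by ring.
assert (Hs : differentiable_pt_lim (fun _ v => v) x y 0 1).
{ intros eps. exists eps. intros u v _ _.
  replace (v - y - (0 * (u - x) + 1 * (v - y))) with 0 by ring.
  rewrite Rabs_R0. apply Rmult_le_pos; [apply Rlt_le, cond_pos |].
  eapply Rle_trans; [apply Rabs_pos | apply Rmax_l]. }
apply H; [| exact Hs | exact Hs].
now apply differentiable_pt_lim_proj1_0.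
Qed.

Lemma differentiable_pt_lim_mult (x y : R) :
  differentiable_pt_lim Rmult x y y x.
Proof.
intros eps. exists eps. intros u v Hu Hv.
replace (u * v - x * y - (y * (u - x) + x * (v - y))) with ((u - x) * (v - y)) by ring.
rewrite Rabs_mult. apply Rmult_le_compat; try apply Rabs_pos; [lra | apply Rmax_r].
Qed.

Lemma differentiable_pt_lim_expC (x y : R) :
  differentiable_pt_lim (fun u v => exp u * cos v) x y (exp x * cos y) (- (exp x * sin y)) /\
  differentiable_pt_lim (fun u v => exp u * sin v) x y (exp x * sin y) (exp x * cos y).
Proof.
split.
- replace (exp x * cos y) with (cos y * exp x + exp x * 0) by ring.
  replace (- (exp x * sin y)) with (cos y * 0 + exp x * - sin y) by ring.
  apply (differentiable_pt_lim_comp Rmult (fun u _ => exp u) (fun _ v => cos v)).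
  + apply differentiable_pt_lim_mult.
  + apply differentiable_pt_lim_proj1_0, derivable_pt_lim_exp.
  + apply differentiable_pt_lim_snd, derivable_pt_lim_cos.
- replace (exp x * sin y) with (sin y * exp x + exp x * 0) by ring.
  replace (exp x * cos y) with (sin y * 0 + exp x * cos y) by ring.
  apply (differentiable_pt_lim_comp Rmult (fun u _ => exp u) (fun _ v => sin v)).
  + apply differentiable_pt_lim_mult.
  + apply differentiable_pt_lim_proj1_0, derivable_pt_lim_exp.
  + apply differentiable_pt_lim_snd, derivable_pt_lim_sin.
Qed.

(** The form is the imaginary part of [h (exp w) dw]. By the Cauchy-Riemann
    equations for [h] and for [exp] both cross derivatives are
    [Re (h' (exp w) * exp w)]. *)
Lemma closed_at_expC (h : C -> C) (l : C) (x y : R) :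
  is_Cderive h (expC x y) l ->
  closed_at (fun u v => Im (h (expC u v))) (fun u v => Re (h (expC u v))) x y.
Proof.
intros Hl.
destruct (is_Cderive_differentiable_pt_lim h _ _ l Hl) as [Hu Hv].
destruct (differentiable_pt_lim_expC x y) as [HX HY].
pose proof (differentiable_pt_lim_comp _ _ _ _ _ _ _ _ _ _ _ Hu HX HY) as HQ.
pose proof (differentiable_pt_lim_comp _ _ _ _ _ _ _ _ _ _ _ Hv HX HY) as HP.
eexists _, _, _; split; [exact HP |].
match goal with |- differentiable_pt_lim _ _ _ ?k _ => 
 replace k with (Re l * (exp x * cos y) + - Im l * (exp x * sin y)) by ring end.
exact HQ.
Qed.

(** In logarithmic coordinates the annulus is a rectangle whose two horizontal
    sides carry the same values by periodicity; as the circulation vanishes, the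
    integrals over the two vertical sides agree. *)
Lemma circle_integral_constant (h : C -> C) (a b : R) : a <= b ->
  (forall x y, a <= x <= b -> exists l, is_Cderive h (expC x y) l) ->
  RInt (fun y => Re (h (expC b y))) 0 (2 * PI)
  = RInt (fun y => Re (h (expC a y))) 0 (2 * PI).
Proof.
intros Hab Hh.
pose proof PI_RGT_0 as Hpi.
assert (E := goursat (fun u v => Im (h (expC u v))) (fun u v => Re (h (expC u v)))
  a b 0 (2 * PI) Hab ltac:(lra)).
unfold circulation in E.
assert (Eper : RInt (fun x => Im (h (expC x (2 * PI)))) a b
  = RInt (fun x => Im (h (expC x 0))) a b).
{ unfold expC. now rewrite cos_2PI, sin_2PI, cos_0, sin_0. }
rewrite Eper in E. 
assert (E' := E ltac:(intros x y Hx _; destruct (Hh x y Hx) as [l Hl]; exact (closed_at_expC h l x y Hl))).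
lra.
Qed.

Lemma ex_RInt_circle (h : C -> C) (a : R) :
  (forall y, exists l, is_Cderive h (expC a y) l) ->
  ex_RInt (fun y => Re (h (expC a y))) 0 (2 * PI).
Proof.
intros Hh. apply (ex_RInt_continuous (V := R_CompleteNormedModule)).
intros y _. destruct (Hh y) as [l Hl].
destruct (closed_at_expC h l a y Hl) as (p & k & q & _ & HQ).
exact (differentiable_pt_lim_continuous_r (fun u v => Re (h (expC u v))) _ _ _ _ HQ).
Qed.

(** The circle means of [g z / z] do not depend on the radius. For small radii
    they are close to [g' 0], while on every circle their real part is at most
    [1 / radius], which tends to [1] at the boundary of the disk. *)
Lemma schwarz_origin_re (g : C -> C) :
  analytic_on_disk g -> g (RtoC 0) = RtoC 0 ->
  (forall z, unit_disk z -> Cmod (g z) <= 1) ->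
  Re (C_derive g (RtoC 0)) <= 1.
Proof.
intros Hg Hg0 Hb.
set (L := C_derive g (RtoC 0)).
set (h := fun z => (g z / z)%C).
assert (Hdisk : forall x y, x < 0 -> unit_disk (expC x y)).
{ intros x y Hx. unfold unit_disk. rewrite Cmod_expC, <- exp_0. now apply exp_increasing. }
assert (Hh : forall x y, x < 0 -> exists l, is_Cderive h (expC x y) l).
{ intros x y Hx. eexists. apply (is_Cderive_div g (fun z => z)).
  - apply is_Cderive_C_derive; [exact Hg | now apply Hdisk].
  - apply is_Cderive_id.
  - apply expC_neq_0. }
assert (Hder : is_Cderive g (RtoC 0) L).
{ apply is_Cderive_C_derive; [exact Hg | exact unit_disk_0]. }
rewrite is_Cderive_eps in Hder.
pose proof PI_RGT_0 as Hpi.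
assert (K : forall eps b, 0 < eps -> b < 0 -> Re L - eps <= exp (- b)).
{ intros eps b Heps Hbneg.
  destruct (Hder eps Heps) as [d [Hd Hy]].
  (* on the circle of radius exp a the difference quotient of g is eps-close to L *)
  set (a := Rmin b (ln (d / 2))).
  assert (Hab : a <= b) by apply Rmin_l.
  assert (Had : exp a < d).
  { apply Rle_lt_trans with (exp (ln (d / 2))).
    - destruct (Rmin_r b (ln (d / 2))) as [H | H].
      + left. now apply exp_increasing.
      + right. now f_equal.
    - rewrite exp_ln; lra. }
  pose proof (circle_integral_constant h a b Hab (fun x y Hx => Hh x y ltac:(lra))) as EI.
  assert (Exa := ex_RInt_circle h a (fun y => Hh a y ltac:(lra))).
  assert (Exb := ex_RInt_circle h b (fun y => Hh b y Hbneg)).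
  assert (Econst : forall k : R, ex_RInt (fun _ : R => k) 0 (2 * PI)) by (intros; apply ex_RInt_const).
  assert (I1 : RInt (fun _ => Re L - eps) 0 (2 * PI) <= RInt (fun y => Re (h (expC a y))) 0 (2 * PI)).
  { apply RInt_le; [lra | apply Econst | exact Exa |].
    intros y _. 
    assert (Hw := Hy (expC a y)).
    replace (expC a y - RtoC 0)%C with (expC a y) in Hw by ring.
    rewrite Cmod_expC in Hw. specialize (Hw Had). rewrite Hg0 in Hw.
    assert (E : Cmod (h (expC a y) - L) <= eps).
    { unfold h. pose proof (expC_neq_0 a y) as Hn.
      replace (g (expC a y) / expC a y - L)%C
        with ((g (expC a y) - RtoC 0 - expC a y * L) / expC a y)%C by (field; exact Hn).
      rewrite Cmod_div, Cmod_expC by exact Hn.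
      apply Rle_div_l; [apply exp_pos | exact Hw]. }
    pose proof (Rle_trans _ _ _ (re_le_Cmod _) E) as E'.
    change (Rabs (Re (h (expC a y)) - Re L) <= eps) in E'.
    apply Rabs_le_between in E'. lra. }
  assert (I2 : RInt (fun y => Re (h (expC b y))) 0 (2 * PI) <= RInt (fun _ => exp (- b)) 0 (2 * PI)).
  { apply RInt_le; [lra | exact Exb | apply Econst |].
    intros y _. eapply Rle_trans; [apply Rle_abs |].
    eapply Rle_trans; [apply re_le_Cmod |].
    unfold h. rewrite Cmod_div, Cmod_expC by apply expC_neq_0.
    rewrite exp_Ropp. rewrite <- (Rmult_1_l (/ exp b)).
    apply Rmult_le_compat_r; [apply Rlt_le, Rinv_0_lt_compat, exp_pos |].
    now apply Hb, Hdisk. }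
  rewrite RInt_const in I1. rewrite EI, RInt_const in I2.
  change ((2 * PI - 0) * (Re L - eps) <= RInt (fun y => Re (h (expC a y))) 0 (2 * PI)) in I1.
  change (RInt (fun y => Re (h (expC a y))) 0 (2 * PI) <= (2 * PI - 0) * exp (- b)) in I2.
  apply Rmult_le_reg_l with (2 * PI - 0); lra. }
destruct (Rle_lt_dec (Re L) 1) as [H | H]; [exact H |].
exfalso.
set (e := (Re L - 1) / 3).
assert (He : 0 < e) by (unfold e; lra).
assert (Hln : 0 < ln (1 + e)) by (rewrite <- ln_1; apply ln_increasing; lra).
pose proof (K e (- ln (1 + e)) He ltac:(lra)) as HK.
rewrite Ropp_involutive, exp_ln in HK by lra. unfold e in HK. lra.
Qed.

(** Rotating a value onto the positive axis reduces bounds of moduli to bounds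
    of real parts. *)
Lemma exists_rotation (z : C) : exists c, Cmod c = 1 /\ (c * z)%C = RtoC (Cmod z).
Proof.
destruct (Ceq_dec z (RtoC 0)) as [-> | Hz].
- exists (RtoC 1). rewrite Cmod_1, Cmod_0. split; [reflexivity | ring].
- assert (Hm : RtoC (Cmod z) <> RtoC 0).
  { intros E. apply RtoC_inj in E. now apply Hz, Cmod_eq_0. }
  exists (RtoC (Cmod z) / z)%C. split.
  + rewrite Cmod_div, Cmod_R, Rabs_pos_eq by (auto using Cmod_ge_0).
    apply Rinv_r. intros E. now apply Hz, Cmod_eq_0.
  + field. exact Hz.
Qed.

Lemma schwarz_origin (g : C -> C) :
  analytic_on_disk g -> g (RtoC 0) = RtoC 0 ->
  (forall z, unit_disk z -> Cmod (g z) <= 1) ->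
  Cmod (C_derive g (RtoC 0)) <= 1.
Proof.
intros Hg Hg0 Hb.
pose proof unit_disk_0 as H0.
destruct (exists_rotation (C_derive g (RtoC 0))) as [c [Hc Hcz]].
assert (Hd : forall z, unit_disk z -> is_Cderive (fun w => c * g w)%C z (c * C_derive g z)%C).
{ intros z Hz. eapply is_Cderive_eq.
  - apply (is_Cderive_mult (fun _ => c) g); [apply is_Cderive_const |].
    now apply is_Cderive_C_derive.
  - ring. }
pose proof (schwarz_origin_re (fun w => c * g w)%C) as H.
assert (E : C_derive (fun w : C => c * g w)%C (RtoC 0) = (c * C_derive g (RtoC 0))%C)
  by exact (is_C_derive_unique _ _ _ (Hd _ H0)).
rewrite E, Hcz in H. change (Re (RtoC (Cmod (C_derive g (RtoC 0))))) with (Cmod (C_derive g (RtoC 0))) in H.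
apply H.
- intros z Hz. eexists. now apply Hd.
- rewrite Hg0. ring.
- intros z Hz. rewrite Cmod_mult, Hc, Rmult_1_l. now apply Hb.
Qed.

Definition moebius (a z : C) : C := ((z + a) / (RtoC 1 + Cconj a * z))%C.

Lemma one_plus_neq_0 (w : C) : Cmod w < 1 -> (RtoC 1 + w)%C <> RtoC 0.
Proof.
intros Hw E. assert (Ew : w = (- RtoC 1)%C).
{ replace w with (RtoC 1 + w - RtoC 1)%C by ring. rewrite E. ring. }
rewrite Ew, Cmod_opp, Cmod_1 in Hw. lra.
Qed.

Lemma moebius_denominator (a z : C) : unit_disk a -> unit_disk z ->
  (RtoC 1 + Cconj a * z)%C <> RtoC 0.
Proof.
unfold unit_disk. intros Ha Hz. apply one_plus_neq_0.
rewrite Cmod_mult, Cmod_conj.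
pose proof (Cmod_ge_0 a). pose proof (Cmod_ge_0 z). nra.
Qed.

Lemma moebius_disk (a z : C) : unit_disk a -> unit_disk z -> unit_disk (moebius a z).
Proof.
intros Ha Hz. pose proof (moebius_denominator a z Ha Hz) as Hn.
unfold unit_disk in *. unfold moebius. rewrite Cmod_div by exact Hn.
apply Cmod_gt_0 in Hn.
apply Rlt_div_l; [exact Hn |]. rewrite Rmult_1_l.
pose proof (Cmod_ge_0 a). pose proof (Cmod_ge_0 z).
apply Rsqr_incrst_0; [| apply Cmod_ge_0 | apply Cmod_ge_0].
rewrite !Rsqr_pow2.
assert (E : Cmod (RtoC 1 + Cconj a * z) ^ 2 - Cmod (z + a) ^ 2
   = (1 - Cmod a ^ 2) * (1 - Cmod z ^ 2)).
{ rewrite !Cmod2_alt. destruct a as [a1 a2], z as [z1 z2]. simpl. ring. }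
assert (0 < (1 - Cmod a ^ 2) * (1 - Cmod z ^ 2)) by (apply Rmult_lt_0_compat; nra).
lra.
Qed.

Lemma is_Cderive_moebius (a z : C) : unit_disk a -> unit_disk z ->
  is_Cderive (moebius a) z
    ((RtoC 1 - a * Cconj a) / ((RtoC 1 + Cconj a * z) * (RtoC 1 + Cconj a * z)))%C.
Proof.
intros Ha Hz. eapply is_Cderive_eq.
- apply (is_Cderive_div (fun w => w + a)%C (fun w => RtoC 1 + Cconj a * w)%C).
  + apply (is_Cderive_plus (fun w => w) (fun _ => a)); [apply is_Cderive_id | apply is_Cderive_const].
  + apply (is_Cderive_plus (fun _ => RtoC 1) (fun w => Cconj a * w)%C); [apply is_Cderive_const |].
    apply (is_Cderive_mult (fun _ => Cconj a) (fun w => w)); [apply is_Cderive_const | apply is_Cderive_id].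
  + now apply moebius_denominator.
- f_equal. ring.
Qed.

Lemma Cmult_conj_Cmod (a : C) : (a * Cconj a)%C = RtoC (Cmod a ^ 2).
Proof. rewrite <- Cmod2_conj. now rewrite RtoC_pow. Qed.

(** Apply the estimate at the origin to [w] conjugated by disk automorphisms
    taking [0] to [z] and [w z] to [0]; their derivatives there are
    [1 - |z|^2] and [1 / (1 - |w z|^2)]. *)
Lemma schwarz_pick (w : C -> C) (z : C) :
  analytic_on_disk w -> (forall z, unit_disk z -> unit_disk (w z)) -> unit_disk z ->
  Cmod (C_derive w z) * (1 - Cmod z ^ 2) <= 1 - Cmod (w z) ^ 2.
Proof.
intros Hw Hmap Hz.
pose proof unit_disk_0 as H0.
assert (Hna : forall a, unit_disk a -> unit_disk (- a)%C)
  by (intros a Ha; unfold unit_disk; now rewrite Cmod_opp).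
set (a := w z).
assert (Ha : unit_disk a) by now apply Hmap.
set (g := fun v => moebius (- a) (w (moebius z v))).
assert (Hg : forall v, unit_disk v -> exists l : C, is_Cderive g v l /\
   (v = RtoC 0 -> l = C_derive w z * (RtoC 1 - z * Cconj z) / (RtoC 1 - a * Cconj a))%C).
{ intros v Hv.
  pose proof (moebius_disk z v Hz Hv) as Hm.
  eexists; split.
  - apply (is_Cderive_comp (moebius (- a)) (fun v => w (moebius z v))).
    + apply is_Cderive_moebius; [now apply Hna | now apply Hmap].
    + apply (is_Cderive_comp w (moebius z)).
      * apply is_Cderive_C_derive; [exact Hw | exact Hm].
      * now apply is_Cderive_moebius.
  - intros ->.
    assert (Ez : moebius z (RtoC 0) = z).
    { unfold moebius. field. }
    rewrite Ez. fold a. rewrite Copp_conj.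
    assert (Hd : (RtoC 1 - a * Cconj a)%C <> RtoC 0).
    { pose proof (moebius_denominator (- a) a (Hna a Ha) Ha) as Hn. rewrite Copp_conj in Hn.
      intros E. apply Hn. rewrite <- E. ring. }
    match goal with |- ?x = ?y => change (@eq C x y) end.
    field.
    intros E. apply Hd. rewrite <- E. ring. }
assert (Hga : analytic_on_disk g).
{ intros v Hv. destruct (Hg v Hv) as [l [Hl _]]. now exists l. }
pose proof (schwarz_origin g Hga) as H.
destruct (Hg _ H0) as [l [Hl El]]. rewrite (is_C_derive_unique _ _ _ Hl), (El eq_refl) in H.
assert (Ha2 : 0 < 1 - Cmod a ^ 2) by (unfold unit_disk in Ha; pose proof (Cmod_ge_0 a); nra).
assert (Hz2 : 0 < 1 - Cmod z ^ 2) by (unfold unit_disk in Hz; pose proof (Cmod_ge_0 z); nra).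
rewrite !Cmult_conj_Cmod, <- !RtoC_minus in H.
assert (Hnz : RtoC (1 - Cmod a ^ 2) <> RtoC 0) by (intros E; apply RtoC_inj in E; lra).
rewrite Cmod_div, Cmod_mult, !Cmod_R, !Rabs_pos_eq in H by (auto; lra).
apply Rle_div_l in H; [rewrite Rmult_1_l in H; exact H | exact Ha2 | |].
- unfold g, moebius.
  replace (RtoC 0 + z)%C with z by ring.
  replace (RtoC 1 + Cconj z * RtoC 0)%C with (RtoC 1) by ring.
  replace (z / RtoC 1)%C with z by (field; apply C1_nz). fold a.
  replace (a + - a)%C with (RtoC 0) by ring. unfold Cdiv. ring.
- intros v Hv. apply Rlt_le. apply moebius_disk; [now apply Hna |].
  now apply Hmap, moebius_disk.
Qed.

Lemma is_derive_Re_ray (F : C -> C) (z l : C) (t : R) :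
  is_Cderive F (RtoC t * z)%C l ->
  is_derive (fun s : R => Re (F (RtoC s * z)%C)) t (Re (z * l)%C).
Proof.
intros H.
assert (E : forall s, (RtoC s * z)%C = (s * Re z, s * Im z)).
{ intros s. destruct z as [x y]. unfold Cmult, RtoC, Re, Im; simpl. f_equal; ring. }
rewrite E in H.
destruct (is_Cderive_differentiable_pt_lim F _ _ l H) as [HRe _].
apply is_derive_Reals.
replace (Re (z * l)%C) with (Re l * Re z + - Im l * Im z)
  by (destruct z, l; unfold Re, Im; simpl; ring).
assert (K : derivable_pt_lim (fun s => Re (F (s * Re z, s * Im z))) t (Re l * Re z + - Im l * Im z)).
{ apply (derivable_pt_lim_comp_2d (fun u v => Re (F (u, v))) (fun s => s * Re z) (fun s => s * Im z)).
  - exact HRe.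
  - apply is_derive_Reals. auto_derive; [trivial | ring].
  - apply is_derive_Reals. auto_derive; [trivial | ring]. }
apply is_derive_Reals. apply is_derive_Reals in K.
apply (is_derive_ext (fun s => Re (F (s * Re z, s * Im z)))); [| exact K].
intros s. now rewrite E.
Qed.

(** Integrate the infinitesimal estimate of [schwarz_pick] along the radius. If
    [u t] is the component of [w (t z)] in the direction of [w z], then [u] moves
    hyperbolically no faster than the point [t |z|], so the pseudo-hyperbolic
    difference [(u - t r) / (1 - u t r)] is nonincreasing; it starts at [0]. *)
Lemma schwarz (w : C -> C) (z : C) :
  analytic_on_disk w -> (forall z, unit_disk z -> unit_disk (w z)) ->
  w (RtoC 0) = RtoC 0 -> unit_disk z -> Cmod (w z) <= Cmod z.
Proof.
intros Hw Hmap Hw0 Hz.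
destruct (exists_rotation (w z)) as [c [Hc Hcw]].
set (r := Cmod z). assert (Hr : 0 <= r < 1) by (split; [apply Cmod_ge_0 | exact Hz]).
set (u := fun t : R => Re (c * w (RtoC t * z)%C)%C).
assert (Hray : forall t, 0 <= t <= 1 -> Cmod (RtoC t * z) = t * r).
{ intros t Ht. rewrite Cmod_mult, Cmod_R, Rabs_pos_eq by lra. reflexivity. }
assert (Hin : forall t, 0 <= t <= 1 -> unit_disk (RtoC t * z)%C).
{ intros t Ht. unfold unit_disk. rewrite Hray by exact Ht. nra. }
assert (Hub : forall t, 0 <= t <= 1 -> u t ^ 2 <= Cmod (w (RtoC t * z)%C) ^ 2 /\ -1 < u t < 1).
{ intros t Ht.
  assert (E : Rabs (u t) <= Cmod (w (RtoC t * z)%C)).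
  { eapply Rle_trans; [apply re_le_Cmod |]. rewrite Cmod_mult, Hc. lra. }
  pose proof (Hmap _ (Hin t Ht)) as Hlt. unfold unit_disk in Hlt.
  split; [| apply Rabs_lt_between; lra].
  rewrite <- (pow2_abs (u t)). apply pow_incr. split; [apply Rabs_pos | exact E]. }
assert (Hd : forall t, 0 <= t <= 1 -> exists u', is_derive u t u' /\
   u' * (1 - (t * r) ^ 2) <= r * (1 - u t ^ 2)).
{ intros t Ht. eexists; split.
  - apply (is_derive_Re_ray (fun v => c * w v)%C).
    apply (is_Cderive_mult (fun _ => c) w); [apply is_Cderive_const |].
    apply is_Cderive_C_derive; [exact Hw | now apply Hin].
  - pose proof (schwarz_pick w _ Hw Hmap (Hin t Ht)) as SP.
    rewrite Hray in SP by exact Ht.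
    set (w' := C_derive w (RtoC t * z)%C) in *.
    assert (E : Re (z * (RtoC 0 * w (RtoC t * z)%C + c * w')) <= r * Cmod w').
    { eapply Rle_trans; [apply Rle_abs |]. eapply Rle_trans; [apply re_le_Cmod |].
      replace (z * (RtoC 0 * w (RtoC t * z)%C + c * w'))%C with (z * (c * w'))%C by ring.
      rewrite !Cmod_mult, Hc. fold r. lra. }
    destruct (Hub t Ht) as [Hu _].
    assert (Htr : 0 <= t * r < 1) by nra.
    assert (0 < 1 - (t * r) ^ 2) by nra.
    apply Rle_trans with (r * (Cmod w' * (1 - (t * r) ^ 2))); [| nra].
    rewrite <- Rmult_assoc. apply Rmult_le_compat_r; [lra | exact E]. }
set (Q := fun t => (u t - t * r) / (1 - u t * (t * r))).
assert (Hden : forall t, 0 <= t <= 1 -> 0 < 1 - u t * (t * r)).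
{ intros t Ht. destruct (Hub t Ht) as [_ Hu]. assert (0 <= t * r < 1) by nra. nra. }
assert (HQ : forall t, 0 <= t <= 1 -> is_derive Q t (Derive Q t) /\ Derive Q t <= 0).
{ intros t Ht. destruct (Hd t Ht) as [u' [Hu' Hle]].
  pose proof (Hden t Ht) as Hp.
  assert (HD : is_derive Q t ((u' * (1 - (t * r) ^ 2) - r * (1 - u t ^ 2)) / (1 - u t * (t * r)) ^ 2)).
  { unfold Q. pose proof (is_derive_unique _ _ _ Hu') as EU.
    assert (Hex : ex_derive u t) by (now exists u').
    auto_derive.
    - repeat split; auto; lra.
    - replace (Derive (fun x : R => u x) t) with u' by (symmetry; exact EU). field. lra. }
  rewrite (is_derive_unique _ _ _ HD). split; [exact HD |].
  apply Rle_div_l; [apply Rlt_gt, pow_lt; exact Hp | lra]. }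
destruct (MVT_gen Q 0 1 (Derive Q)) as [t [Ht E]].
- rewrite Rmin_left, Rmax_right by lra. intros t Ht. apply HQ. lra.
- rewrite Rmin_left, Rmax_right by lra. intros t Ht.
  apply derivable_continuous_pt. exists (Derive Q t). apply is_derive_Reals, HQ. lra.
- rewrite Rmin_left, Rmax_right in Ht by lra.
  destruct (HQ t Ht) as [_ Hneg].
  assert (u0 : u 0 = 0).
  { unfold u. replace (RtoC 0 * z)%C with (RtoC 0) by ring. rewrite Hw0.
    replace (c * RtoC 0)%C with (RtoC 0) by ring. reflexivity. }
  assert (u1 : u 1 = Cmod (w z)).
  { unfold u. replace (RtoC 1 * z)%C with z by ring. rewrite Hcw. reflexivity. }
  assert (Q0 : Q 0 = 0) by (unfold Q; rewrite u0; field).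
  pose proof (Hden 1 ltac:(lra)) as H1.
  assert (Q1 : Q 1 <= 0) by lra.
  unfold Q in Q1. apply Rle_div_l in Q1; [| exact H1]. lra.
Qed.

(** * The pre-Schwarzian in terms of z f' / f *)

(** A function continuous at [0] whose derivative has a limit there is
    differentiable at [0]: the mean value theorem along the segment from [0] to
    [y] bounds the error of the linear approximation. *)
Lemma is_Cderive_removable (g : C -> C) (L : C) :
  (forall eps, 0 < eps -> exists d, 0 < d /\ forall y, Cmod y < d ->
     Cmod (g y - g (RtoC 0)) <= eps) ->
  (forall eps, 0 < eps -> exists d, 0 < d /\ forall y, y <> RtoC 0 -> Cmod y < d ->
     exists l, is_Cderive g y l /\ Cmod (l - L) <= eps) ->
  is_Cderive g (RtoC 0) L.
Proof.
intros Hcont Hder. apply is_Cderive_eps. intros eps Heps.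
destruct (Hder eps Heps) as [d [Hd Hl]]. exists d; split; [exact Hd |].
intros y Hy. replace (y - RtoC 0)%C with y in * by ring.
destruct (Ceq_dec y (RtoC 0)) as [-> | Hy0].
{ replace (g (RtoC 0) - g (RtoC 0) - RtoC 0 * L)%C with (RtoC 0) by ring. rewrite Cmod_0. lra. }
destruct (exists_rotation (g y - g (RtoC 0) - y * L)%C) as [c [Hc Hcz]].
set (psi := fun t : R => Re (c * (g (RtoC t * y)%C - (RtoC t * y) * L))%C).
assert (Hray : forall t, Cmod (RtoC t * y) = Rabs t * Cmod y)
  by (intros t; now rewrite Cmod_mult, Cmod_R).
assert (Hpsi : forall t, 0 < t <= 1 -> exists k, is_derive psi t k /\ k <= eps * Cmod y).
{ intros t Ht. 
  destruct (Hl (RtoC t * y)%C) as [l [Hlt HlL]].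
  - apply Cmod_gt_0. rewrite Hray, Rabs_pos_eq by lra. apply Cmod_gt_0 in Hy0. nra.
  - rewrite Hray, Rabs_pos_eq by lra. pose proof (Cmod_ge_0 y). nra.
  - eexists; split.
    + apply (is_derive_Re_ray (fun v => c * (g v - v * L))%C).
      apply (is_Cderive_mult (fun _ => c) (fun v => g v - v * L)%C); [apply is_Cderive_const |].
      apply (is_Cderive_minus g (fun v => v * L)%C); [exact Hlt |].
      apply (is_Cderive_mult (fun v => v) (fun _ => L)); [apply is_Cderive_id | apply is_Cderive_const].
    + eapply Rle_trans; [apply Rle_abs |]. eapply Rle_trans; [apply re_le_Cmod |].
      match goal with |- Cmod ?e <= _ => replace e with (y * (c * (l - L)))%C by ring end.
      rewrite !Cmod_mult, Hc, Rmult_1_l, Rmult_comm.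
      apply Rmult_le_compat_r; [apply Cmod_ge_0 | exact HlL]. }
(* the mean value theorem may return the endpoint 0, where psi need not be differentiable *)
destruct (MVT_gen psi 0 1 (fun t => if Rle_dec t 0 then 0 else Derive psi t)) as [t [Ht E]].
- rewrite Rmin_left, Rmax_right by lra. intros t Ht.
  destruct (Rle_dec t 0) as [Hn | _]; [lra |].
  destruct (Hpsi t ltac:(lra)) as [k [Hk _]]. apply Derive_correct. now exists k.
- rewrite Rmin_left, Rmax_right by lra. intros t Ht.
  destruct (Rle_lt_or_eq_dec 0 t (proj1 Ht)) as [Hpos | <-].
  + destruct (Hpsi t ltac:(lra)) as [k [Hk _]].
    apply derivable_continuous_pt. exists k. now apply is_derive_Reals.
  + intros e He.
    assert (HL : 0 < Cmod y * Cmod L + 1)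
      by (pose proof (Cmod_ge_0 y); pose proof (Cmod_ge_0 L); nra).
    destruct (Hcont (e / 3) ltac:(lra)) as [d' [Hd' Hg]].
    assert (Hy1 : 0 < Cmod y) by now apply Cmod_gt_0.
    exists (Rmin (d' / Cmod y) (e / 3 / (Cmod y * Cmod L + 1))). split.
    { apply Rmin_pos; repeat apply Rdiv_lt_0_compat; lra. }
    intros t [_ Htd]. 
    change (Rabs (t - 0) < Rmin (d' / Cmod y) (e / 3 / (Cmod y * Cmod L + 1))) in Htd.
    change (Rabs (psi t - psi 0) < e).
    rewrite Rminus_0_r in Htd.
    assert (Ht1 : Rabs t * Cmod y < d').
    { apply Rlt_div_r; [exact Hy1 |]. eapply Rlt_le_trans; [exact Htd | apply Rmin_l]. }
    assert (Ht2 : Rabs t * (Cmod y * Cmod L + 1) < e / 3).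
    { apply Rlt_div_r; [exact HL |]. eapply Rlt_le_trans; [exact Htd | apply Rmin_r]. }
    assert (Ediff : psi t - psi 0 = Re (c * ((g (RtoC t * y)%C - g (RtoC 0)) - (RtoC t * y) * L))%C).
    { unfold psi. replace (RtoC 0 * y)%C with (RtoC 0) by ring.
      match goal with |- Re ?a - Re ?b = _ => change (Re (a - b)%C = Re (c * (g (RtoC t * y)%C - g (RtoC 0) - RtoC t * y * L))%C) end.
      f_equal. ring. }
    rewrite Ediff. eapply Rle_lt_trans; [apply re_le_Cmod |].
    rewrite Cmod_mult, Hc, Rmult_1_l.
    unfold Cminus at 1. eapply Rle_lt_trans; [apply Cmod_triangle |].
    rewrite Cmod_opp, Cmod_mult, Hray.
    pose proof (Hg (RtoC t * y)%C ltac:(rewrite Hray; exact Ht1)).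
    pose proof (Rabs_pos t). nra.
- rewrite Rmin_left, Rmax_right in Ht by lra.
  assert (E1 : psi 1 - psi 0 = Cmod (g y - g (RtoC 0) - y * L)).
  { assert (psi 1 - psi 0 = Re (c * (g y - g (RtoC 0) - y * L))%C).
    { unfold psi. replace (RtoC 0 * y)%C with (RtoC 0) by ring. replace (RtoC 1 * y)%C with y by ring.
      match goal with |- Re ?a - Re ?b = _ => change (Re (a - b)%C = Re (c * (g y - g (RtoC 0) - y * L))%C) end.
      f_equal. ring. }
    rewrite H, Hcz. reflexivity. }
  rewrite <- E1, E, Rminus_0_r, Rmult_1_r.
  destruct (Rle_dec t 0) as [_ | Hn].
  + apply Rmult_le_pos; [lra | apply Cmod_ge_0].
  + destruct (Hpsi t ltac:(lra)) as [k [Hk Hle]]. now rewrite (is_derive_unique _ _ _ Hk).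
Qed.

Lemma unit_disk_near (z y : C) : Cmod (y - z) < 1 - Cmod z -> unit_disk y.
Proof.
intros H. unfold unit_disk.
replace y with (z + (y - z))%C by ring.
eapply Rle_lt_trans; [apply Cmod_triangle | lra].
Qed.

(** Throughout, [p = z f' / f], so that [f' = p * (f / z)]. The logarithmic
    derivative of [f / z] is [(p - 1) / z], which only involves [p]; hence [f']
    is a product of functions with known derivatives. *)
Section LogDerivative.
Variables f p p' : C -> C.
Hypothesis Hf : class_A f.
Hypothesis Hf0 : forall z, unit_disk z -> z <> RtoC 0 -> f z <> RtoC 0.
Hypothesis Hp : forall z, unit_disk z -> is_Cderive p z (p' z).
Hypothesis Hp0 : p (RtoC 0) = RtoC 1.
Hypothesis Hfp : forall z, unit_disk z -> z <> RtoC 0 -> (z * C_derive f z / f z)%C = p z.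

Definition quot (z : C) : C := if Ceq_dec z (RtoC 0) then RtoC 1 else (f z / z)%C.
(** The logarithmic derivative of [quot], with the limit of [(p z - 1) / z]
    as its value at [0]. *)
Definition log_quot_derivative (z : C) : C :=
  if Ceq_dec z (RtoC 0) then p' (RtoC 0) else ((p z - RtoC 1) / z)%C.

Lemma quot_0 : quot (RtoC 0) = RtoC 1.
Proof. unfold quot. destruct Ceq_dec; [reflexivity | now contradict n]. Qed.

Lemma quot_neq (z : C) : z <> RtoC 0 -> quot z = (f z / z)%C.
Proof. unfold quot. now destruct Ceq_dec. Qed.

Lemma quot_nonzero (z : C) : unit_disk z -> quot z <> RtoC 0.
Proof.
intros Hz. unfold quot. destruct Ceq_dec as [E | E]; [apply C1_nz |].
intros E0. apply (Hf0 z Hz E). replace (f z) with (f z / z * z)%C by (field; exact E).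
rewrite E0. ring.
Qed.

Lemma C_derive_eq_quot (z : C) : unit_disk z -> C_derive f z = (p z * quot z)%C.
Proof.
intros Hz. unfold quot. destruct Ceq_dec as [-> | E].
- rewrite Hp0. destruct Hf as (_ & _ & ->). ring.
- rewrite <- Hfp by assumption. field. auto.
Qed.

Lemma is_Cderive_quot_neq (z : C) : unit_disk z -> z <> RtoC 0 ->
  is_Cderive quot z (quot z * ((p z - RtoC 1) / z))%C.
Proof.
intros Hz H0.
apply (is_Cderive_ext_near (fun v => f v / v)%C quot z _ (Cmod z)); [now apply Cmod_gt_0 | |].
- intros v Hv. symmetry. apply quot_neq. intros ->.
  replace (RtoC 0 - z)%C with (- z)%C in Hv by ring. rewrite Cmod_opp in Hv. lra.
- eapply is_Cderive_eq.
  + apply (is_Cderive_div f (fun v => v)); [| apply is_Cderive_id | exact H0].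
    apply is_Cderive_C_derive; [apply Hf | exact Hz].
  + rewrite C_derive_eq_quot, !quot_neq by assumption. 
    match goal with |- ?x = ?y => change (@eq C x y) end. field. exact H0.
Qed.

(** At the origin this is the removable-singularity lemma: [quot] tends to
    [f' 0 = 1] and its derivative [quot * (p - 1) / z] tends to [p' 0]. *)
Lemma is_Cderive_quot (z : C) : unit_disk z ->
  is_Cderive quot z (quot z * log_quot_derivative z)%C.
Proof.
intros Hz. unfold log_quot_derivative. destruct Ceq_dec as [-> | H0]; [| now apply is_Cderive_quot_neq].
rewrite quot_0. replace (RtoC 1 * p' (RtoC 0))%C with (p' (RtoC 0)) by ring.
set (L := p' (RtoC 0)).
assert (Hq1 : forall eps, 0 < eps -> exists d, 0 < d /\ forall y, Cmod y < d ->
     Cmod (quot y - RtoC 1) <= eps).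
{ intros eps Heps.
  pose proof (is_Cderive_C_derive f _ (proj1 Hf) Hz) as Hd.
  destruct Hf as (_ & Hf00 & Hf1). rewrite Hf1, is_Cderive_eps in Hd.
  destruct (Hd eps Heps) as [d [Hdpos Hy]]. exists d; split; [exact Hdpos |].
  intros y Hyd. specialize (Hy y). replace (y - RtoC 0)%C with y in Hy by ring.
  specialize (Hy Hyd). rewrite Hf00 in Hy.
  destruct (Ceq_dec y (RtoC 0)) as [-> | H0].
  - rewrite quot_0. replace (RtoC 1 - RtoC 1)%C with (RtoC 0) by ring. rewrite Cmod_0. lra.
  - rewrite quot_neq by exact H0.
    replace (f y / y - RtoC 1)%C with ((f y - RtoC 0 - y * RtoC 1) / y)%C by (field; exact H0).
    rewrite Cmod_div by exact H0. apply Rle_div_l; [now apply Cmod_gt_0 | exact Hy]. }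
apply is_Cderive_removable.
- rewrite quot_0. exact Hq1.
- intros eps Heps. pose proof (Cmod_ge_0 L) as HL.
  set (e := Rmin 1 (eps / (Cmod L + 2))).
  assert (He : 0 < e) by (apply Rmin_pos; [lra | apply Rdiv_lt_0_compat; lra]).
  assert (He1 : e <= 1) by apply Rmin_l.
  assert (He2 : e * (Cmod L + 2) <= eps) by (apply Rle_div_r; [lra | apply Rmin_r]).
  destruct (Hq1 e He) as [d1 [Hd1 Hy1]].
  pose proof (Hp _ Hz) as Hpd. fold L in Hpd. rewrite is_Cderive_eps in Hpd.
  destruct (Hpd e He) as [d2 [Hd2 Hy2]].
  exists (Rmin 1 (Rmin d1 d2)); split; [repeat apply Rmin_pos; lra |].
  intros y H0 Hy.
  assert (Hyd : Cmod y < 1 /\ Cmod y < d1 /\ Cmod y < d2).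
  { pose proof (Rmin_l 1 (Rmin d1 d2)). pose proof (Rmin_r 1 (Rmin d1 d2)).
    pose proof (Rmin_l d1 d2). pose proof (Rmin_r d1 d2). lra. }
  eexists; split; [apply is_Cderive_quot_neq; [apply Hyd | exact H0] |].
  specialize (Hy1 y ltac:(lra)). specialize (Hy2 y).
  replace (y - RtoC 0)%C with y in Hy2 by ring. specialize (Hy2 ltac:(lra)).
  rewrite Hp0 in Hy2.
  set (D := ((p y - RtoC 1) / y)%C).
  assert (HD : Cmod (D - L) <= e).
  { unfold D. replace ((p y - RtoC 1) / y - L)%C with ((p y - RtoC 1 - y * L) / y)%C by (field; exact H0).
    rewrite Cmod_div by exact H0. apply Rle_div_l; [now apply Cmod_gt_0 | exact Hy2]. }
  replace (quot y * D - L)%C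
    with ((quot y - RtoC 1) * (D - L) + (quot y - RtoC 1) * L + (D - L))%C by ring.
  eapply Rle_trans; [apply Cmod_triangle |].
  eapply Rle_trans; [apply Rplus_le_compat_r, Cmod_triangle |].
  rewrite !Cmod_mult.
  pose proof (Cmod_ge_0 (quot y - RtoC 1)). pose proof (Cmod_ge_0 (D - L)). nra.
Qed.

Lemma pre_schwarzian_eq (z : C) : unit_disk z -> p z <> RtoC 0 ->
  pre_schwarzian f z = (p' z / p z + log_quot_derivative z)%C.
Proof.
intros Hz Hpz. unfold pre_schwarzian.
assert (HD : is_Cderive (C_derive f) z (p' z * quot z + p z * (quot z * log_quot_derivative z))%C).
{ apply (is_Cderive_ext_near (fun v => p v * quot v)%C _ z _ (1 - Cmod z)).
  - unfold unit_disk in Hz. lra.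
  - intros v Hv. symmetry. apply C_derive_eq_quot. now apply (unit_disk_near z).
  - apply is_Cderive_mult; [now apply Hp | now apply is_Cderive_quot]. }
rewrite (is_C_derive_unique _ _ _ HD), C_derive_eq_quot by exact Hz.
field. split; [exact Hpz | now apply quot_nonzero].
Qed.
End LogDerivative.

(** * The extremal problem for the radial bound *)

(** The pre-Schwarzian estimate obtained when the subordinating function takes
    a value of modulus [t]. *)
Definition radial_bound (sigma t : R) : R :=
  (1 - sigma + 2 * sigma * t) * (1 + t) / (1 + sigma * t)
  + (1 - t ^ 2) * (1 - sigma + sigma * t).

(** The numerator of the derivative of [radial_bound sigma]. *)
Definition quartic (sigma t : R) : R :=
  - 3 * sigma ^ 3 * t ^ 4
  + (2 * sigma ^ 3 - 8 * sigma ^ 2) * t ^ 3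
  + (sigma ^ 3 + 6 * sigma ^ 2 - 7 * sigma) * t ^ 2
  + (2 * sigma ^ 2 + 6 * sigma - 2) * t
  + sigma ^ 2 + sigma + 1.

Lemma is_derive_radial_bound (sigma t : R) : 0 <= sigma -> 0 <= t ->
  is_derive (radial_bound sigma) t (quartic sigma t / (1 + sigma * t) ^ 2).
Proof.
intros Hs Ht. assert (0 < 1 + sigma * t) by nra.
unfold radial_bound, quartic. auto_derive; [lra |]. field. lra.
Qed.

Lemma quartic_0_pos sigma : 0 <= sigma -> 0 < quartic sigma 0.
Proof. intros. unfold quartic. nra. Qed.
Lemma quartic_1_neg sigma : 0 <= sigma <= 1 / 3 -> quartic sigma 1 < 0.
Proof. intros. unfold quartic. nra. Qed.


(** Concavity of the quartic on the positive axis, as a chord inequality with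
    left endpoint [0]. The factor displayed in the proof is minus the second
    divided difference of the quartic at [0, x, y], up to [sigma]. *)
Lemma quartic_above_chord (sigma x y : R) : 0 <= sigma <= 1 / 3 -> 0 <= x <= y ->
  (y - x) * quartic sigma 0 + x * quartic sigma y <= y * quartic sigma x.
Proof.
intros Hs Hxy.
assert (E : y * quartic sigma x - (y - x) * quartic sigma 0 - x * quartic sigma y
  = x * y * (y - x) * sigma *
    (3 * sigma ^ 2 * (x ^ 2 + x * y + y ^ 2) + (8 * sigma - 2 * sigma ^ 2) * (x + y)
     + (7 - 6 * sigma - sigma ^ 2))).
{ unfold quartic. ring. }
enough (0 <= x * y * (y - x) * sigma *
    (3 * sigma ^ 2 * (x ^ 2 + x * y + y ^ 2) + (8 * sigma - 2 * sigma ^ 2) * (x + y)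
     + (7 - 6 * sigma - sigma ^ 2))) by lra.
apply Rmult_le_pos; [repeat apply Rmult_le_pos; lra |].
apply Rplus_le_le_0_compat; [apply Rplus_le_le_0_compat |]; [| | nra];
  apply Rmult_le_pos; nra.
Qed.

(** The quartic is positive at [0] and negative at [1], and by concavity it
    changes sign once. *)
Lemma quartic_root (sigma : R) : 0 <= sigma <= 1 / 3 ->
  exists t, 0 < t < 1 /\ quartic sigma t = 0 /\
    (forall s, 0 <= s < t -> 0 < quartic sigma s) /\
    (forall s, t < s -> quartic sigma s < 0).
Proof.
intros Hs. pose proof (quartic_0_pos sigma (proj1 Hs)) as H0.
pose proof (quartic_1_neg sigma Hs) as H1.
assert (Hc : continuity (fun t => - quartic sigma t)) by (unfold quartic; reg).
destruct (IVT (fun t => - quartic sigma t) 0 1 Hc) as [t [Ht Hroot]]; [lra | lra | lra |].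
assert (Hr : quartic sigma t = 0) by lra.
assert (Ht' : 0 < t < 1).
{ split; apply Rnot_le_lt; intros Hle.
  - replace t with 0 in Hr by lra. lra.
  - replace t with 1 in Hr by lra. lra. }
exists t. split; [exact Ht' | split; [exact Hr | split]]; intros s Hst.
- pose proof (quartic_above_chord sigma s t Hs ltac:(lra)) as E. rewrite Hr in E. nra.
- pose proof (quartic_above_chord sigma t s Hs ltac:(lra)) as E. rewrite Hr in E. nra.
Qed.

Lemma radial_bound_le_at_root (sigma t s : R) : 0 <= sigma -> 0 < t -> 
  (forall s, 0 <= s < t -> 0 < quartic sigma s) ->
  (forall s, t < s -> quartic sigma s < 0) ->
  quartic sigma t = 0 -> 0 <= s -> radial_bound sigma s <= radial_bound sigma t.
Proof.
intros Hs Ht Hpos Hneg H0 Hs0.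
set (N := fun v => quartic sigma v / (1 + sigma * v) ^ 2).
destruct (MVT_gen (radial_bound sigma) s t N) as [c [Hc E]].
- intros v Hv. apply is_derive_radial_bound; [exact Hs |].
  unfold Rmin in Hv. destruct (Rle_dec s t); lra.
- intros v Hv. apply derivable_continuous_pt. exists (N v).
  apply is_derive_Reals, is_derive_radial_bound; [exact Hs |].
  unfold Rmin in Hv. destruct (Rle_dec s t); lra.
- enough (0 <= N c * (t - s)) by lra.
  assert (Hc0 : 0 <= c) by (unfold Rmin in Hc; destruct (Rle_dec s t); lra).
  unfold N, Rdiv. rewrite Rmult_assoc, (Rmult_comm (/ _)), <- Rmult_assoc.
  apply Rmult_le_pos; [| apply Rlt_le, Rinv_0_lt_compat, pow_lt; nra].
  unfold Rmin, Rmax in Hc. destruct (Rtotal_order c t) as [L | [-> | L]].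
  + destruct (Rle_dec s t); [| lra]. pose proof (Hpos c ltac:(lra)). nra.
  + rewrite H0. lra.
  + destruct (Rle_dec s t); [lra |]. pose proof (Hneg c ltac:(lra)). nra.
Qed.

(** * The pre-Schwarzian estimate for the limacon class *)

(** Among the points of modulus [s] the left-hand side is largest at [- s]. This
    holds for [|1 + w|] by the triangle inequality, and the quotient of the two
    other moduli squared is a nonincreasing function of [Re w]. *)
Lemma limacon_log_derivative_bound (sigma : R) (w : C) : 0 <= sigma <= 1 / 3 -> Cmod w < 1 ->
  (1 - Cmod w ^ 2) * (Cmod (RtoC (1 - sigma) - RtoC (2 * sigma) * w)
     / (Cmod (RtoC 1 + w) * Cmod (RtoC 1 - RtoC sigma * w)))
  <= (1 - sigma + 2 * sigma * Cmod w) * (1 + Cmod w) / (1 + sigma * Cmod w).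
Proof.
intros Hs Hw. set (s := Cmod w) in *.
assert (Hs0 : 0 <= s) by apply Cmod_ge_0.
assert (H1 : 1 - s <= Cmod (RtoC 1 + w)).
{ assert (1 <= Cmod (RtoC 1 + w) + s); [| lra].
  rewrite <- Cmod_1 at 1. replace (RtoC 1) with ((RtoC 1 + w) + - w)%C at 1 by ring.
  eapply Rle_trans; [apply Cmod_triangle |]. rewrite Cmod_opp. unfold s. lra. }
assert (H2 : 0 < Cmod (RtoC 1 - RtoC sigma * w)).
{ assert (1 <= Cmod (RtoC 1 - RtoC sigma * w) + sigma * s); [| nra].
  rewrite <- Cmod_1 at 1. 
  replace (RtoC 1) with ((RtoC 1 - RtoC sigma * w) + RtoC sigma * w)%C at 1 by ring.
  eapply Rle_trans; [apply Cmod_triangle |]. rewrite Cmod_mult, Cmod_R, Rabs_pos_eq by lra.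
  unfold s. lra. }
assert (H3 : Cmod (RtoC (1 - sigma) - RtoC (2 * sigma) * w) * (1 + sigma * s)
   <= (1 - sigma + 2 * sigma * s) * Cmod (RtoC 1 - RtoC sigma * w)).
{ pose proof (Cmod_ge_0 (RtoC (1 - sigma) - RtoC (2 * sigma) * w)).
  assert (0 <= sigma * s) by (apply Rmult_le_pos; lra).
  apply Rsqr_incr_0; [| apply Rmult_le_pos; lra | apply Rmult_le_pos; lra].
  rewrite !Rsqr_mult, !Rsqr_pow2, !Cmod2_alt.
  assert (Hx : - s <= Re w) by (pose proof (re_le_Cmod w) as Hre; apply Rabs_le_between in Hre; unfold s; lra).
  assert (Hs2 : s ^ 2 = Re w ^ 2 + Im w ^ 2) by (unfold s; apply Cmod2_alt).
  replace (Re (RtoC (1 - sigma) - RtoC (2 * sigma) * w) ^ 2 + Im (RtoC (1 - sigma) - RtoC (2 * sigma) * w) ^ 2)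
    with ((1 - sigma) ^ 2 - 4 * (1 - sigma) * sigma * Re w + 4 * sigma ^ 2 * s ^ 2)
    by (rewrite Hs2; destruct w; unfold Re, Im; simpl; ring).
  replace (Re (RtoC 1 - RtoC sigma * w) ^ 2 + Im (RtoC 1 - RtoC sigma * w) ^ 2)
    with (1 - 2 * sigma * Re w + sigma ^ 2 * s ^ 2)
    by (rewrite Hs2; destruct w; unfold Re, Im; simpl; ring).
  clear Hs2. generalize dependent (Re w). intros x Hx.
  assert (E : (1 - sigma + 2 * sigma * s) ^ 2 * (1 - 2 * sigma * x + sigma ^ 2 * s ^ 2)
    - ((1 - sigma) ^ 2 - 4 * (1 - sigma) * sigma * x + 4 * sigma ^ 2 * s ^ 2) * (1 + sigma * s) ^ 2
    = 2 * sigma * (1 + sigma) * (1 - sigma - 2 * sigma ^ 2 * s ^ 2) * (x + s)) by ring.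
  assert (0 <= 2 * sigma * (1 + sigma) * (1 - sigma - 2 * sigma ^ 2 * s ^ 2) * (x + s)).
  { apply Rmult_le_pos; [apply Rmult_le_pos; [apply Rmult_le_pos; lra |] | lra].
    assert (sigma ^ 2 <= 1 / 9) by nra. assert (s ^ 2 <= 1) by nra.
    assert (sigma ^ 2 * s ^ 2 <= 1 / 9 * 1) by (apply Rmult_le_compat; nra). lra. }
  lra. }
set (A := Cmod (RtoC (1 - sigma) - RtoC (2 * sigma) * w)) in *.
set (B := Cmod (RtoC 1 + w)) in *. set (D := Cmod (RtoC 1 - RtoC sigma * w)) in *.
assert (HA : 0 <= A) by apply Cmod_ge_0.
assert (Hsig : 0 < 1 + sigma * s) by nra.
assert (HAD : A / D <= (1 - sigma + 2 * sigma * s) / (1 + sigma * s)).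
{ apply Rle_div_l; [exact H2 |].
  replace ((1 - sigma + 2 * sigma * s) / (1 + sigma * s) * D)
   with (((1 - sigma + 2 * sigma * s) * D) / (1 + sigma * s)) by (field; lra).
  apply Rle_div_r; [exact Hsig | lra]. }
assert (HB : (1 - s ^ 2) / B <= 1 + s) by (apply Rle_div_l; [lra | nra]).
replace ((1 - s ^ 2) * (A / (B * D))) with ((A / D) * ((1 - s ^ 2) / B)) by (field; lra).
replace ((1 - sigma + 2 * sigma * s) * (1 + s) / (1 + sigma * s))
  with ((1 - sigma + 2 * sigma * s) / (1 + sigma * s) * (1 + s)) by (field; lra).
apply Rmult_le_compat; [| | exact HAD | exact HB].
- apply Rdiv_le_0_compat; lra.
- apply Rdiv_le_0_compat; [nra | lra].
Qed.

Lemma limacon_neq_0 (sigma : R) (w : C) : 0 <= sigma <= 1 / 3 -> Cmod w < 1 ->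
  (RtoC 1 + w)%C <> RtoC 0 /\ (RtoC 1 - RtoC sigma * w)%C <> RtoC 0.
Proof.
intros Hs Hw. split; [now apply one_plus_neq_0 |].
apply (one_plus_neq_0 (- (RtoC sigma * w))).
rewrite Cmod_opp, Cmod_mult, Cmod_R, Rabs_pos_eq by lra. pose proof (Cmod_ge_0 w). nra.
Qed.

Lemma is_Cderive_limacon (sigma : R) (w : C -> C) (z dw : C) :
  is_Cderive w z dw ->
  is_Cderive (fun v => limacon sigma (w v)) z
    (dw * (RtoC (1 - sigma) - RtoC (2 * sigma) * w z))%C.
Proof.
intros Hw. eapply is_Cderive_eq.
- apply (is_Cderive_mult (fun v => RtoC 1 + w v)%C (fun v => RtoC 1 - RtoC sigma * w v)%C).
  + apply (is_Cderive_plus (fun _ => RtoC 1) w); [apply is_Cderive_const | exact Hw].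
  + apply (is_Cderive_minus (fun _ => RtoC 1) (fun v => RtoC sigma * w v)%C); [apply is_Cderive_const |].
    apply (is_Cderive_mult (fun _ => RtoC sigma) w); [apply is_Cderive_const | exact Hw].
- rewrite RtoC_minus, RtoC_mult. 
  match goal with |- ?x = ?y => change (@eq C x y) end. ring.
Qed.

(** With [s = |w z|] and [r = |z|], the invariant Schwarz lemma bounds the part
    [p' / p] and removes its dependence on [r]. For the part [(p - 1) / z], of
    modulus at most [s (1 - sigma + sigma s) / r], the factor [(1 - r^2) / r] is
    decreasing and [s <= r], so [r] may be replaced by [s]. *)
Lemma pre_schwarzian_le_radial_bound (sigma : R) (f : C -> C) :
  0 <= sigma <= 1 / 3 -> S_lim sigma f -> forall z, unit_disk z ->
  exists s, 0 <= s /\ (1 - Cmod z ^ 2) * Cmod (pre_schwarzian f z) <= radial_bound sigma s.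
Proof.
intros Hs (Hf & Hf0 & w & Hw & Hmap & Hw0 & Hsub) z Hz.
exists (Cmod (w z)). split; [apply Cmod_ge_0 |].
set (p := fun v => limacon sigma (w v)).
set (p' := fun v => (C_derive w v * (RtoC (1 - sigma) - RtoC (2 * sigma) * w v))%C).
assert (Hp : forall v, unit_disk v -> is_Cderive p v (p' v)).
{ intros v Hv. now apply is_Cderive_limacon, is_Cderive_C_derive. }
assert (Hp0 : p (RtoC 0) = RtoC 1) by (unfold p, limacon; rewrite Hw0; ring).
assert (Hfp : forall v, unit_disk v -> v <> RtoC 0 -> (v * C_derive f v / f v)%C = p v).
{ intros v Hv H0. unfold p. rewrite <- Hsub by exact Hv. unfold zf'_over_f.
  now destruct Ceq_dec. }
destruct (limacon_neq_0 sigma (w z) Hs (Hmap z Hz)) as [Hn1 Hn2].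
rewrite (pre_schwarzian_eq f p p' Hf Hf0 Hp Hp0 Hfp z Hz) by now apply Cmult_neq_0.
pose proof (schwarz_pick w z Hw Hmap Hz) as SP.
pose proof (schwarz w z Hw Hmap Hw0 Hz) as SL.
pose proof (Hmap z Hz) as Hws. unfold unit_disk in Hz, Hws.
set (r := Cmod z) in *. set (s := Cmod (w z)) in *.
assert (Hs0 : 0 <= s) by apply Cmod_ge_0.
assert (Hr2 : 0 < 1 - r ^ 2) by nra.
assert (B1 : (1 - r ^ 2) * Cmod (p' z / p z)
   <= (1 - sigma + 2 * sigma * s) * (1 + s) / (1 + sigma * s)).
{ eapply Rle_trans; [| apply limacon_log_derivative_bound; [exact Hs | exact Hws]].
  fold s. unfold p', p, limacon. rewrite Cmod_div by now apply Cmult_neq_0.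
  rewrite !Cmod_mult. unfold Rdiv. rewrite <- !Rmult_assoc.
  apply Rmult_le_compat_r.
  - apply Rlt_le, Rinv_0_lt_compat, Rmult_lt_0_compat; now apply Cmod_gt_0.
  - apply Rmult_le_compat_r; [apply Cmod_ge_0 | lra]. }
assert (B2 : (1 - r ^ 2) * Cmod (log_quot_derivative p p' z) <= (1 - s ^ 2) * (1 - sigma + sigma * s)).
{ unfold log_quot_derivative. destruct Ceq_dec as [Ez | H0].
  - assert (Hr : r = 0) by (unfold r; rewrite Ez; apply Cmod_0).
    assert (Hs' : s = 0) by lra.
    unfold p'. rewrite Ez in SP. rewrite Hw0.
    replace (RtoC (1 - sigma) - RtoC (2 * sigma) * RtoC 0)%C with (RtoC (1 - sigma)) by ring.
    rewrite Cmod_mult, Cmod_R, Rabs_pos_eq by lra.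
    rewrite Hr, Hs' in *. pose proof (Cmod_ge_0 (C_derive w (RtoC 0))). nra.
  - assert (Hr : 0 < r) by now apply Cmod_gt_0.
    assert (Hnum : Cmod (p z - RtoC 1) <= s * (1 - sigma + sigma * s)).
    { unfold p, limacon.
      replace ((RtoC 1 + w z) * (RtoC 1 - RtoC sigma * w z) - RtoC 1)%C
        with (w z * (RtoC (1 - sigma) + - (RtoC sigma * w z)))%C by (rewrite RtoC_minus; ring).
      rewrite Cmod_mult. fold s. apply Rmult_le_compat_l; [exact Hs0 |].
      eapply Rle_trans; [apply Cmod_triangle |].
      rewrite Cmod_opp, Cmod_mult, !Cmod_R, !Rabs_pos_eq by lra. fold s. lra. }
    assert (Hrs : (1 - r ^ 2) * s <= (1 - s ^ 2) * r).
    { assert (0 <= (r - s) * (1 + r * s)) by (apply Rmult_le_pos; nra). nra. }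
    rewrite Cmod_div by exact H0. fold r.
    replace ((1 - r ^ 2) * (Cmod (p z - RtoC 1) / r))
      with ((1 - r ^ 2) * Cmod (p z - RtoC 1) / r) by (field; lra).
    apply Rle_div_l; [lra |].
    apply Rle_trans with ((1 - r ^ 2) * s * (1 - sigma + sigma * s)).
    + rewrite Rmult_assoc. apply Rmult_le_compat_l; [lra | exact Hnum].
    + replace ((1 - s ^ 2) * (1 - sigma + sigma * s) * r)
        with ((1 - s ^ 2) * r * (1 - sigma + sigma * s)) by ring.
      apply Rmult_le_compat_r; [nra | exact Hrs]. }
eapply Rle_trans; [apply Rmult_le_compat_l; [lra | apply Cmod_triangle] |].
unfold radial_bound. lra.
Qed.

Theorem corollary4p5 :
  forall sigma : R, 0 <= sigma <= 1 / 3 ->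
  exists t : R,
    unique (fun t : R =>
      0 < t < 1 /\
      (- 3 * sigma ^ 3 * t ^ 4
       + (2 * sigma ^ 3 - 8 * sigma ^ 2) * t ^ 3
       + (sigma ^ 3 + 6 * sigma ^ 2 - 7 * sigma) * t ^ 2
       + (2 * sigma ^ 2 + 6 * sigma - 2) * t
       + sigma ^ 2 + sigma + 1) / (1 + sigma * t) ^ 2 = 0) t /\
    forall f : C -> C, S_lim sigma f ->
      Rbar_le (pre_schwarzian_norm f)
        (Finite ((1 - sigma + 2 * sigma * t) * (1 + t) / (1 + sigma * t)
                 + (1 - t ^ 2) * (1 - sigma + sigma * t))).
Proof.
intros sigma Hs.
destruct (quartic_root sigma Hs) as (t & Ht & Hroot & Hpos & Hneg).
exists t. split; [split |].
- split; [exact Ht |]. fold (quartic sigma t). rewrite Hroot. apply Rdiv_0_l.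
- intros t' [Ht' E]. fold (quartic sigma t') in E.
  assert (Hn : 0 < / (1 + sigma * t') ^ 2) by (apply Rinv_0_lt_compat, pow_lt; nra).
  destruct (Rtotal_order t t') as [L | [L | L]]; [| exact L |]; exfalso.
  + pose proof (Hneg t' L). unfold Rdiv in E. nra.
  + pose proof (Hpos t' ltac:(lra)). unfold Rdiv in E. nra.
- intros f Hf. apply Lub_Rbar_correct. intros x (z & Hz & ->).
  destruct (pre_schwarzian_le_radial_bound sigma f Hs Hf z Hz) as (s & Hs0 & Hle).
  apply (Rle_trans _ _ _ Hle).
  now apply (radial_bound_le_at_root sigma t s).
Qed.
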